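(* For uniform metrical task systems, the deterministic LPS algorithm, with access to a PST oracle whose prediction error is at most $\eta_0$, is $\Theta(\sqrt{\eta_0})$-competitive.
   Context: Uniform metrical task system: a finite set $S$ of $n$ states with transition costs $d(s,s')=1$ for $s\ne s'$ and $d(s,s)=0$. A task is an array $T$ of length $n$, where $T[i]$ is the cost of processing it in state $s_i$. The input is a sequence of tasks, one per time step; an online algorithm chooses at each time $t$ a state $\sigma(t)$, knowing only the tasks up to time $t$, its past states, and any oracle advice; its cost on a sequence is the sum over $t$ of $d(\sigma(t-1),\sigma(t))$ and of the processing cost of the $t$-th task in $\sigma(t)$, with $\sigma(0)=s_1$. Competitiveness is in the standard worst-case sense, comparing the algorithm's cost with that of the optimal offline algorithm. Phases and saturation: at the start of a phase all states are unsaturated. A state $s$ is saturated at time $t$ if the total cost of processing, in state $s$, all tasks arriving from the start of the phase through time $t$ is at least $1$; its saturation time in the phase is the first such $t$. When all states are saturated the next phase begins and all states are again unsaturated. A BLS phase algorithm is an algorithm that runs in phases, never processes tasks in a saturated state, and only leaves its current state when that state becomes saturated. PST (Predicted Saturation Time) oracle: at the beginning of each phase it outputs an array $h$ without ties, where $h[i]$ is the predicted saturation time of state $s_i$ in that phase. If $t_i$ is the true saturation time of $s_i$, the prediction error is $\eta=\sum_{i=1}^n |h[i]-t_i|$. In the worst-case analysis an adversary chooses both the task sequence and the oracle's predictions, subject to $\eta\le\eta_0$. LPS (Last Predicted State) algorithm: the BLS phase algorithm which queries the PST oracle at the beginning of each phase and always transitions to the unsaturated state with the latest predicted saturation time (at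 the start of the phase, and whenever its current state becomes saturated while unsaturated states remain).
   Formalization: Every task must cost less than 1 in some state (otherwise LPS, which never processes in a saturated state, is undefined); the lower bound is stated only when the square root of η0 is at most the number of states (it fails for fixed n and large η0); both bounds hold for all large η0. *)

(* Defs.v *)
From mathcomp Require Import all_boot all_order all_algebra.
From mathcomp Require Import classical_sets reals.

Set Implicit Arguments.
Unset Strict Implicit.
Unset Printing Implicit Defensive.

Import Order.TTheory GRing.Theory Num.Theory.
Local Open Scope ring_scope.

(* The states are s_1, ..., s_{n+1}, represented by 'I_n.+1 (so that there is *)
(* at least one state); s_1 is ord0.  Time steps are 1, 2, ...; time 0 only   *)
(* carries the initial state.                                                 *)
Definition task (R : realType) (n : nat) := 'I_n.+1 -> R.

Definition schedule (n : nat) := nat -> 'I_n.+1.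

(* An oracle's output: [h p] is the array produced at the beginning of the    *)
(* phase that starts at time p.  Values at other times are never used.        *)
Definition predictions (n : nat) := nat -> 'I_n.+1 -> nat.

Section UniformMTS.
Variables (R : realType) (n : nat).
Implicit Types (ts : seq (task R n)) (h : predictions n) (sigma : schedule n).
Implicit Types (s : 'I_n.+1) (p t : nat).

(* The task arriving at time t >= 1; no cost after the end of the input.      *)
Definition task_at ts t : task R n := nth (fun=> 0) ts t.-1.

Definition dist s s' : R := if s == s' then 0 else 1.

Definition cost ts sigma : R :=
  \sum_(1 <= t < (size ts).+1)
    (dist (sigma t.-1) (sigma t) + task_at ts t (sigma t)).

Definition opt ts : R :=
  inf [set cost ts sigma | sigma in [set sigma | sigma 0%N = ord0]]%classic.

(* Saturation of s at time t, relative to a phase starting at time p.         *)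
Definition saturated ts p t s : bool :=
  1 <= \sum_(p <= u < t.+1) task_at ts u s.

(* The starting time of the phase in progress at time t.  The next phase      *)
(* begins at the very time step t at which the last state gets saturated: all *)
(* states are then unsaturated again, and the task arriving at time t is the  *)
(* first task of the new phase, in which it is processed and counted.         *)
Fixpoint phase_start ts t : nat :=
  if t is t'.+1 then
    let p := phase_start ts t' in
    if [forall s, saturated ts p t s] then t else p
  else 1%N.

Definition saturation_time ts p s t : Prop :=
  [/\ (p <= t)%N, saturated ts p t s
    & forall u : nat, (p <= u < t)%N -> ~~ saturated ts p u s].

Definition prediction_error (hp tt : 'I_n.+1 -> nat) : R :=
  \sum_s `|(hp s)%:R - (tt s)%:R|.

(* No ties in any phase, and error at most eta0 in every phase in which all   *)
(* the true saturation times exist, that is, in every phase except the last   *)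
(* one, which the end of the input interrupts.                                *)
Definition PST_oracle ts h (eta0 : R) : Prop :=
  forall p, phase_start ts p = p ->
    injective (h p) /\
    forall tt : 'I_n.+1 -> nat, (forall s, saturation_time ts p s (tt s)) ->
      prediction_error (h p) tt <= eta0.

(* A task costing at least 1 in every state would saturate all the states on  *)
(* arrival, in whatever phase, so that it could not be processed in an        *)
(* unsaturated state: no phase algorithm is defined on such a task.           *)
Definition valid_input ts : Prop :=
  forall t, (forall s, 0 <= task_at ts t s) /\ (exists s, task_at ts t s < 1).

(* The unsaturated state at time t with the latest predicted saturation time. *)
Definition last_predicted ts p t (hp : 'I_n.+1 -> nat) : option 'I_n.+1 :=
  [pick s | ~~ saturated ts p t s &
    [forall s', ~~ saturated ts p t s' ==> (hp s' <= hp s)%N]].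

(* The state at time t depends on the tasks up to time t and on the oracle's  *)
(* outputs for the phases started by time t.  On valid inputs last_predicted  *)
(* is never None, see LPS_unsaturated.                                        *)
Fixpoint LPS ts h t : 'I_n.+1 :=
  if t is t'.+1 then
    let cur := LPS ts h t' in
    let p := phase_start ts t in
    if (p == t) || saturated ts p t cur
    then odflt cur (last_predicted ts p t (h p))
    else cur
  else ord0.

(* The additive constant may depend on the task system and on eta0, but not   *)
(* on the input and the predictions.                                          *)
Definition competitive (alg : seq (task R n) -> predictions n -> schedule n)
    (eta0 c : R) : Prop :=
  exists b : R, forall ts h, valid_input ts -> PST_oracle ts h eta0 ->
    cost ts (alg ts h) <= c * opt ts + b.

Lemma phase_start_unsaturated ts t : valid_input ts -> (0 < t)%N ->
  exists s, ~~ saturated ts (phase_start ts t) t s.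
Proof.
move=> vts; case: t => //= t _.
case: ifPn => [_|/forallPn //].
have [_ [s lt1]] := vts t.+1; exists s.
by rewrite /saturated big_nat1 -ltNge.
Qed.

(* LPS never processes a task in a saturated state.                           *)
Lemma LPS_unsaturated ts h t : valid_input ts -> (0 < t)%N ->
  ~~ saturated ts (phase_start ts t) t (LPS ts h t).
Proof.
move=> vts t_gt0; have [s0 us0] := phase_start_unsaturated vts t_gt0.
case: t t_gt0 us0 => // t _ us0.
have -> : LPS ts h t.+1 = let p := phase_start ts t.+1 in
  if (p == t.+1) || saturated ts p t.+1 (LPS ts h t)
  then odflt (LPS ts h t) (last_predicted ts p t.+1 (h p)) else LPS ts h t by [].
move: (phase_start _ _) us0 => p us0 /=.
case: ifPn => [_|]; last by rewrite negb_or => /andP[].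
rewrite /last_predicted; case: pickP => [s /andP[] //|none].
have := none [arg max_(s > s0 | ~~ saturated ts p t.+1 s) h p s].
case: arg_maxnP => // s us smax; rewrite us /= => /negbT/forallPn[s'].
by rewrite negb_imply => /andP[us' /negP[]]; apply: smax.
Qed.

End UniformMTS.

(* Main.v *)
Require Import Defs.
From mathcomp Require Import all_boot all_order all_algebra.
From mathcomp Require Import classical_sets reals.
From mathcomp Require Import zify ring lra.

(** Upper bound: the state occupied by LPS has the latest prediction among all
    unsaturated states at all times, hence LPS visits the states of a phase in
    decreasing order of their predictions and in increasing order of their
    saturation times.  The signed errors of the k visited states are therefore
    distinct integers, so that the prediction error is at least of order k^2,
    while LPS pays at most 2k in the phase.  Any schedule pays at least 1 over a
    phase together with the task opening the next one.

    Lower bound: the tasks charge 1 to the states in cyclic order, so that the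
    n+1 states are saturated one per time step in each phase, whatever its
    starting time.  The oracle reverses the last k saturation times, with error
    at most k^2; LPS then moves at each of the last steps of the phase, whereas
    moving once, to the last state to be saturated, makes the phase free. *)

Set Implicit Arguments.
Unset Strict Implicit.
Unset Printing Implicit Defensive.

Import Order.TTheory GRing.Theory Num.Theory.
Local Open Scope ring_scope.

Lemma absz_natrB (F : numDomainType) (a b : nat) :
  `|a%:R - b%:R| = (`|a%:Z - b%:Z|%N)%:R :> F.
Proof. by rewrite natr_absz intr_norm rmorphB. Qed.

Lemma card_absz_small (T : finType) (A : {set T}) (d : T -> int) m :
  {in A &, injective d} -> (#|[set s in A | `|d s| < m]| <= 2 * m)%N.
Proof.
move=> inj_d; case: m => [|m].
  by rewrite leqn0 cards_eq0; apply/eqP/setP => s; rewrite !inE ltn0 andbF.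
have -> : (2 * m.+1 = #|'I_(2 * m).+2|)%N by rewrite card_ord mulnS.
apply: (@leq_card_in _ _ (fun s => inord (absz (d s + m%:Z)))) => s s'.
rewrite !inE => /andP[sA ds] /andP[s'A ds'] /(congr1 (@nat_of_ord _)).
by rewrite !inordK; [move=> E; apply: inj_d => //; lia | lia | lia].
Qed.

Lemma sum_absz_inj (T : finType) (A : {set T}) (d : T -> int) :
  {in A &, injective d} -> (#|A| ^ 2 <= 8 * \sum_(s in A) `|d s| + 9)%N.
Proof.
move=> inj_d; pose m := (#|A| %/ 4)%N.
have small := card_absz_small m inj_d.
have large : (m * #|[set s in A | m <= `|d s|]| <= \sum_(s in A) `|d s|)%N.
  rewrite mulnC -sum_nat_const [leqRHS](bigID (fun s => m <= `|d s|)%N) /=.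
  apply: leq_trans (leq_addr _ _).
  rewrite (eq_bigl (fun s => (s \in A) && (m <= `|d s|)%N)); last first.
    by move=> s; rewrite inE.
  by apply: leq_sum => s /andP[].
have split : (#|A| = #|[set s in A | (m <= `|d s|)%N]| + #|[set s in A | (`|d s| < m)%N]|)%N.
  rewrite -(cardsID [set s | (m <= `|d s|)%N] A).
  by congr (_ + _)%N; apply: eq_card => s; rewrite !inE -?ltnNge // andbC.
have := divn_eq #|A| 4; rewrite -/m => k4; have := ltn_pmod #|A| (isT : (0 < 4)%N).
set k := #|A| in k4 split *; set r := (k %% 4)%N in k4 * => r4.
have lm : (m * (2 * m + r) <= \sum_(s in A) `|d s|)%N.
  by apply: leq_trans large; rewrite leq_mul2l; lia.
nia.
Qed.

Section Upper.
Variables (R : realType) (n : nat).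
Implicit Types (ts : seq (task R n)) (h : predictions n) (sigma : schedule n).
Implicit Types (s : 'I_n.+1) (p t u : nat).

Definition step_cost ts sigma t : R :=
  dist R (sigma t.-1) (sigma t) + task_at ts t (sigma t).

Lemma dist_ge0 s s' : 0 <= dist R s s'.
Proof. by rewrite /dist; case: ifP. Qed.

Lemma dist_le1 s s' : dist R s s' <= 1.
Proof. by rewrite /dist; case: ifP. Qed.

Lemma step_cost_ge0 ts sigma t : valid_input ts -> 0 <= step_cost ts sigma t.
Proof. by move=> vts; rewrite addr_ge0 ?dist_ge0 //; case: (vts t). Qed.

Lemma cost_ge0 ts sigma : valid_input ts -> 0 <= cost ts sigma.
Proof. by move=> vts; apply: sumr_ge0 => t _; apply: step_cost_ge0. Qed.

Lemma opt_ge ts (x : R) :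
  (forall sigma, sigma 0%N = ord0 -> x <= cost ts sigma) -> x <= opt ts.
Proof.
move=> lex; apply: lb_le_inf; first by exists (cost ts (fun=> ord0)), (fun=> ord0).
by move=> _ [sigma s0 <-]; apply: lex.
Qed.

Lemma opt_le ts sigma : valid_input ts -> sigma 0%N = ord0 ->
  opt ts <= cost ts sigma.
Proof.
move=> vts s0; apply: ge_inf; last by exists sigma.
by exists 0 => _ [sigma' _ <-]; apply: cost_ge0.
Qed.

Lemma saturated_le ts p t t' s : valid_input ts -> (t <= t')%N ->
  saturated ts p t s -> saturated ts p t' s.
Proof.
move=> vts le_t; rewrite /saturated => /le_trans; apply.
have [lt_tp|le_pt] := ltnP t p.
  by rewrite big_geq // sumr_ge0 // => u _; case: (vts u).
rewrite [leRHS](big_cat_nat (n := t.+1)) ?ltnS //=; last exact: leqW.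
by rewrite lerDl sumr_ge0 // => u _; case: (vts u).
Qed.

Lemma saturated_geq ts p t s : saturated ts p t s -> (p <= t)%N.
Proof.
by rewrite leqNgt /saturated; apply: contraL => lt_tp; rewrite big_geq // ler10.
Qed.

Lemma phase_start_gt0 ts t : (0 < phase_start ts t)%N.
Proof. by elim: t => //= t IH; case: ifP. Qed.

Lemma phase_start_le ts t : (0 < t)%N -> (phase_start ts t <= t)%N.
Proof.
elim: t => // t IH _ /=; case: ifP => // _.
by case: t IH => // t IH; apply/leqW/IH.
Qed.

Lemma phase_startS ts t :
  phase_start ts t.+1 = t.+1 \/ phase_start ts t.+1 = phase_start ts t.
Proof. by rewrite /=; case: ifP; [left|right]. Qed.

Lemma phase_start_const ts t u :
  (phase_start ts t <= u <= t)%N -> phase_start ts u = phase_start ts t.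
Proof.
elim: t u => [|t IH] u; first by rewrite leqn0 => /andP[_ /eqP->].
have [E|E] := phase_startS ts t.
  by rewrite E -eqn_leq => /eqP <-; rewrite E.
rewrite E => /andP[le_pu]; rewrite leq_eqVlt => /predU1P[->//|le_ut].
by apply: IH; rewrite le_pu.
Qed.

Lemma phase_start_idem ts t : phase_start ts (phase_start ts t) = phase_start ts t.
Proof.
case: t => [|t]; last by apply: phase_start_const; rewrite leqnn phase_start_le.
by apply/eqP; rewrite eqn_leq phase_start_le ?phase_start_gt0.
Qed.

Lemma LPS_latest ts h t s : valid_input ts -> (0 < t)%N ->
  ~~ saturated ts (phase_start ts t) t s ->
  (h (phase_start ts t) s <= h (phase_start ts t) (LPS ts h t))%N.
Proof.
move=> vts; elim: t s => // t IH s _.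
have -> : LPS ts h t.+1 = let p := phase_start ts t.+1 in
  if (p == t.+1) || saturated ts p t.+1 (LPS ts h t)
  then odflt (LPS ts h t) (last_predicted ts p t.+1 (h p)) else LPS ts h t by [].
move Ep: (phase_start ts t.+1) => p us /=; case: ifPn => [_|].
  rewrite /last_predicted; case: pickP => [s1 /andP[_ /forallP/(_ s)]|none].
    by rewrite us.
  have := none [arg max_(s1 > s | ~~ saturated ts p t.+1 s1) h p s1].
  case: arg_maxnP => // s1 us1 smax; rewrite us1 /= => /negbT/forallPn[s'].
  by rewrite negb_imply => /andP[us' /negP[]]; apply: smax.
rewrite negb_or => /andP[pt us0].
have [E|E] := phase_startS ts t; first by rewrite -Ep E eqxx in pt.
rewrite Ep in E; rewrite {}E in us pt Ep us0 *.
case: t {us0} IH us pt Ep => [|t] IH us pt Ep; first by move: pt.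
by apply: IH => //; apply: contra us; apply: saturated_le.
Qed.

Definition visited ts h p t : {set 'I_n.+1} :=
  [set s in [seq LPS ts h u | u <- index_iota p t.+1]].

Lemma visitedP ts h p t s :
  reflect (exists2 u, (p <= u <= t)%N & LPS ts h u = s) (s \in visited ts h p t).
Proof.
rewrite inE; apply: (iffP mapP) => -[u].
  by rewrite mem_index_iota ltnS => ? ->; exists u.
by move=> ? <-; exists u; rewrite ?mem_index_iota ?ltnS.
Qed.

Lemma phase_visit ts h t s : valid_input ts ->
  s \in visited ts h (phase_start ts t) t ->
  exists u, [/\ (phase_start ts t <= u <= t)%N, LPS ts h u = s,
    ~~ saturated ts (phase_start ts t) u s
    & forall s', ~~ saturated ts (phase_start ts t) u s' ->
        (h (phase_start ts t) s' <= h (phase_start ts t) s)%N].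
Proof.
move=> vts /visitedP[u pu <-]; exists u.
have u0 : (0 < u)%N.
  by case/andP: pu => pu _; apply: leq_trans pu; apply: phase_start_gt0.
have := @LPS_unsaturated _ _ ts h u vts u0.
have := fun s => @LPS_latest ts h u s vts u0.
by rewrite (phase_start_const pu).
Qed.

Lemma LPS_new ts h t : valid_input ts -> injective (h (phase_start ts t.+1)) ->
  (phase_start ts t.+1 <= t)%N -> LPS ts h t != LPS ts h t.+1 ->
  LPS ts h t.+1 \notin visited ts h (phase_start ts t.+1) t.
Proof.
move=> vts inj_h pt; apply: contraNN => vis.
have E : phase_start ts t = phase_start ts t.+1.
  by apply: phase_start_const; rewrite pt leqnSn.
have t0 : (0 < t)%N by apply: leq_trans pt; apply: phase_start_gt0.
rewrite -E in vis inj_h *; case: (phase_visit vts vis) => u [/andP[pu ut] _ _ umax].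
have us' := @LPS_unsaturated _ _ ts h t.+1 vts isT; rewrite -E in us'.
apply/eqP/inj_h/eqP; rewrite eqn_leq; apply/andP; split.
- apply: umax; apply: contra (@LPS_unsaturated _ _ ts h t vts t0).
  exact: saturated_le.
- apply: LPS_latest => //; apply: contra us'; exact: saturated_le.
Qed.

Lemma phase_moves ts h t : valid_input ts -> injective (h (phase_start ts t)) ->
  (0 < t)%N ->
  \sum_(phase_start ts t <= u < t.+1) dist R (LPS ts h u.-1) (LPS ts h u)
    <= #|visited ts h (phase_start ts t) t|%:R.
Proof.
move=> vts; elim: t => // t IH inj_h _.
have [E|E] := phase_startS ts t.
  rewrite E big_nat1; apply: le_trans (dist_le1 _ _) _.
  rewrite ler1n; apply/card_gt0P; exists (LPS ts h t.+1).
  by apply/visitedP; exists t.+1; rewrite ?leqnn.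
case: (posnP t) => [t0|t0].
  move: E; rewrite t0 => E.
  rewrite E big_nat1; apply: le_trans (dist_le1 _ _) _.
  rewrite ler1n; apply/card_gt0P; exists (LPS ts h 1).
  by apply/visitedP; exists 1%N.
have pt : (phase_start ts t.+1 <= t)%N by rewrite E phase_start_le.
rewrite big_nat_recr /=; last exact: leqW.
have sub : visited ts h (phase_start ts t.+1) t
    \subset visited ts h (phase_start ts t.+1) t.+1.
  apply/fintype.subsetP => s /visitedP[u /andP[pu ut] <-]; apply/visitedP; exists u => //.
  by rewrite pu leqW.
have {}IH : \sum_(phase_start ts t.+1 <= u < t.+1) dist R (LPS ts h u.-1) (LPS ts h u)
    <= #|visited ts h (phase_start ts t.+1) t|%:R.
  by rewrite E; apply: IH => //; rewrite -E.
case: (eqVneq (LPS ts h t) (LPS ts h t.+1)) => [eqL|neL].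
  have -> : dist R (LPS ts h t) (LPS ts h t.+1) = 0 by rewrite /dist eqL eqxx.
  rewrite addr0; apply: le_trans IH _.
  by rewrite ler_nat subset_leq_card.
have new := LPS_new vts inj_h pt neL.
have vis1 : LPS ts h t.+1 \in visited ts h (phase_start ts t.+1) t.+1.
  by apply/visitedP; exists t.+1; rewrite ?leqnn // (leq_trans pt).
apply: le_trans (lerD IH (dist_le1 _ _)) _.
rewrite natr1 ler_nat; apply: proper_card; apply/properP; split=> //.
by exists (LPS ts h t.+1).
Qed.

Lemma phase_processing1 ts h t s : valid_input ts -> (0 < t)%N ->
  \sum_(phase_start ts t <= u < t.+1 | LPS ts h u == s) task_at ts u s <= 1.
Proof.
move=> vts; elim: t => // t IH _.
set p := phase_start ts t.+1.
have [eqL|neL] := eqVneq (LPS ts h t.+1) s.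
  have := @LPS_unsaturated _ _ ts h t.+1 vts isT.
  rewrite eqL /saturated -ltNge => /ltW; apply: le_trans.
  rewrite [leLHS]big_mkcond; apply: ler_sum => u _.
  by case: ifP => // _; case: (vts u).
have pt : (p <= t.+1)%N by apply: phase_start_le.
rewrite big_mkcond big_nat_recr //= (negPf neL) addr0 -big_mkcond.
have [E|E] := phase_startS ts t; rewrite -/p in E.
  by rewrite E big_geq // ler01.
rewrite E; case: (posnP t) => [->|t0]; last exact: IH.
by rewrite big_geq ?ler01.
Qed.

Lemma phase_processing ts h t : valid_input ts -> (0 < t)%N ->
  \sum_(phase_start ts t <= u < t.+1) task_at ts u (LPS ts h u)
    <= #|visited ts h (phase_start ts t) t|%:R.
Proof.
move=> vts t0; set p := phase_start ts t.
rewrite big_seq_cond.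
rewrite (partition_big (LPS ts h) (mem (visited ts h p t))) /=; last first.
  move=> u /andP[]; rewrite mem_index_iota ltnS => pu _.
  by apply/visitedP; exists u.
rewrite -sum1_card natr_sum; apply: ler_sum => s _.
apply: le_trans (phase_processing1 h s vts t0).
rewrite (eq_bigl (fun u => (u \in index_iota p t.+1) && (LPS ts h u == s))); last first.
  by move=> u; rewrite andbT.
rewrite -big_seq_cond.
by apply: ler_sum => u /eqP ->.
Qed.

Lemma phase_cost ts h t : valid_input ts -> injective (h (phase_start ts t)) ->
  (0 < t)%N ->
  \sum_(phase_start ts t <= u < t.+1) step_cost ts (LPS ts h) u
    <= 2 * #|visited ts h (phase_start ts t) t|%:R.
Proof.
move=> vts inj_h t0; rewrite big_split mulr2n mulrDl mul1r.
by apply: lerD; [apply: phase_moves|apply: phase_processing].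
Qed.

Lemma saturation_time_exists ts p e s : saturated ts p e s ->
  exists t, saturation_time ts p s t.
Proof.
move=> sat_e; pose P t := saturated ts p t s.
have exP : exists t, P t by exists e.
case: (ex_minnP exP) => t Pt tmin; exists t; split=> //; first exact: saturated_geq Pt.
by move=> u /andP[_]; rewrite ltnNge; apply: contra; apply: tmin.
Qed.

Lemma saturation_time_gt ts p s t u : valid_input ts -> saturation_time ts p s t ->
  ~~ saturated ts p u s -> (u < t)%N.
Proof.
move=> vts [_ sat_t _]; apply: contraNT; rewrite -leqNgt => le_tu.
exact: saturated_le sat_t.
Qed.

Lemma saturation_time_le ts p s t u : saturation_time ts p s t ->
  saturated ts p u s -> (t <= u)%N.
Proof.
move=> [_ _ tmin] sat_u; rewrite leqNgt; apply/negP => lt_ut.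
by have := tmin u; rewrite lt_ut (saturated_geq sat_u) => /(_ isT)/negP; apply.
Qed.

(* Of two visited states, the one predicted to last longer is saturated first, *)
(* so that the signed prediction errors of the visited states are distinct.    *)
Lemma visited_error_inj ts h t (tt : 'I_n.+1 -> nat) :
  valid_input ts -> injective (h (phase_start ts t)) ->
  (forall s, saturation_time ts (phase_start ts t) s (tt s)) ->
  {in visited ts h (phase_start ts t) t &,
    injective (fun s => (h (phase_start ts t) s)%:Z - (tt s)%:Z)}.
Proof.
move=> vts inj_h sat_tt.
have later s s' : s \in visited ts h (phase_start ts t) t ->
    (h (phase_start ts t) s < h (phase_start ts t) s')%N -> (tt s' < tt s)%N.
  move=> /(phase_visit vts)[u [_ _ us smax]] lt_h.
  apply: leq_ltn_trans (saturation_time_gt vts (sat_tt s) us).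
  apply: saturation_time_le (sat_tt s') _.
  by apply: contraLR lt_h => us'; rewrite -leqNgt; apply: smax.
move=> s s' vs vs' /= E; apply: inj_h.
case: (ltngtP (h (phase_start ts t) s) (h (phase_start ts t) s')) => // lt_h.
  by have := later _ _ vs lt_h; lia.
by have := later _ _ vs' lt_h; lia.
Qed.

Lemma visited_bound ts h (eta0 : R) t : valid_input ts -> PST_oracle ts h eta0 ->
  (forall s, saturated ts (phase_start ts t) t.+1 s) ->
  #|visited ts h (phase_start ts t) t|%:R ^+ 2 <= 8 * eta0 + 9.
Proof.
move=> vts pst sat.
have [tt sat_tt] := fin_all_exists (fun s => saturation_time_exists (sat s)).
have [inj_h /(_ tt sat_tt) err] := pst _ (phase_start_idem ts t).
have := sum_absz_inj (visited_error_inj vts inj_h sat_tt).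
rewrite -(ler_nat R) natrX => /le_trans; apply.
rewrite natrD natrM lerD2r ler_wpM2l //; apply: le_trans err.
rewrite natr_sum /prediction_error [leRHS](bigID [in visited ts h (phase_start ts t) t]) /=.
rewrite -[leLHS]addr0; apply: lerD; last exact: sumr_ge0.
by apply: ler_sum => s _; rewrite absz_natrB.
Qed.

(* Either sigma moves within the phase, or it processes there a whole phase in *)
(* one state, including the task of time t.+1, which opens the next phase.     *)
Lemma phase_opt ts sigma p t : valid_input ts -> (p <= t)%N ->
  (forall s, saturated ts p t.+1 s) ->
  1 <= \sum_(p <= u < t.+2) step_cost ts sigma u.
Proof.
move=> vts pt sat.
have [/allP still|/allPn[u]] :=
    boolP (all (fun u => sigma u.-1 == sigma u) (index_iota p.+1 t.+2)).
  have same u : (p <= u < t.+2)%N -> sigma u = sigma p.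
    elim: u => [|u IH]; first by rewrite leqn0 => /andP[/eqP ->].
    move=> /andP[pu ut]; move: (pu); rewrite leq_eqVlt => /predU1P[->//|lt_pu].
    rewrite -IH; last by rewrite -ltnS lt_pu ltnW.
    by apply/esym/eqP/(still u.+1); rewrite mem_index_iota lt_pu.
  apply: le_trans (sat (sigma p)) _.
  rewrite big_seq [leRHS]big_seq; apply: ler_sum => u.
  by rewrite mem_index_iota => /same E; rewrite /step_cost E lerDr dist_ge0.
rewrite mem_index_iota => /andP[pu ut] move_u.
rewrite (bigD1_seq u) /= ?iota_uniq ?mem_index_iota ?ut ?(ltnW pu) //.
rewrite -[leLHS]addr0; apply: lerD; last by apply: sumr_ge0 => v _; apply: step_cost_ge0.
rewrite /step_cost {1}/dist (negPf move_u) lerDl.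
by case: (vts u).
Qed.

(* The task opening a phase also ends the previous one, whence the two partial *)
(* sums of the cost of sigma.                                                  *)
Lemma LPS_cost_le ts h (eta0 k : R) sigma t : valid_input ts ->
  PST_oracle ts h eta0 -> 0 <= k -> 8 * eta0 + 9 <= k ^+ 2 ->
  \sum_(1 <= u < phase_start ts t) step_cost ts (LPS ts h) u <=
    2 * k * (\sum_(1 <= u < (phase_start ts t).+1) step_cost ts sigma u
            + \sum_(1 <= u < phase_start ts t) step_cost ts sigma u).
Proof.
move=> vts pst k0 etak.
have sum_ge0 a b : 0 <= \sum_(a <= u < b) step_cost ts sigma u.
  by apply: sumr_ge0 => u _; apply: step_cost_ge0.
have sum1 : \sum_(1 <= u < 1) step_cost ts (LPS ts h) u <=
    2 * k * (\sum_(1 <= u < 2) step_cost ts sigma u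
            + \sum_(1 <= u < 1) step_cost ts sigma u).
  by rewrite big_geq // !mulr_ge0 // addr_ge0.
elim: t => // t IH; have [E|->//] := phase_startS ts t.
case: (posnP t) => [t0|t0]; first by rewrite E t0.
have sat s : saturated ts (phase_start ts t) t.+1 s.
  move: E => /=; case: ifP => [/forallP/(_ s)//|_ E].
  by have := phase_start_le ts t0; rewrite E ltnn.
have pt := phase_start_le ts t0; have p0 := phase_start_gt0 ts t.
have cost_p := phase_cost vts (pst _ (phase_start_idem ts t)).1 t0.
have vis : #|visited ts h (phase_start ts t) t|%:R <= k.
  rewrite -(ler_pXn2r (n := 2)) ?nnegrE //.
  exact: le_trans (visited_bound vts pst sat) etak.
have opt_p := phase_opt sigma vts pt sat.
rewrite E (big_cat_nat (n := phase_start ts t)) //=; last exact: leqW.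
rewrite [X in _ * (X + _)](big_cat_nat (n := phase_start ts t)) //=; last by rewrite !leqW.
have sub : \sum_(1 <= u < (phase_start ts t).+1) step_cost ts sigma u
    <= \sum_(1 <= u < t.+1) step_cost ts sigma u.
  by rewrite [leRHS](big_cat_nat (n := (phase_start ts t).+1)) //= lerDl.
move: IH cost_p opt_p sub.
set A := \sum_(1 <= u < phase_start ts t) _.
set B := \sum_(1 <= u < (phase_start ts t).+1) _.
set C := \sum_(1 <= u < phase_start ts t) _.
set D := \sum_(phase_start ts t <= u < t.+1) _.
set X := \sum_(phase_start ts t <= u < t.+2) _.
set F := \sum_(1 <= u < t.+1) _ => IH cost_p opt_p sub.
have : 2 * k * (1 + B + C) <= 2 * k * (C + X + F).
  by rewrite ler_wpM2l ?mulr_ge0 //; lra.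
by rewrite -addrA mulrDr mulr1; lra.
Qed.

Lemma LPS_competitive (eta0 k : R) : 0 < k -> 8 * eta0 + 9 <= k ^+ 2 ->
  competitive (@LPS R n) eta0 (4 * k).
Proof.
move=> k0 etak; exists (2 * n.+1%:R) => ts h vts pst.
rewrite -lerBlDr [leRHS]mulrC -ler_pdivrMr ?mulr_gt0 //; apply: opt_ge => sigma _.
rewrite ler_pdivrMr ?mulr_gt0 // lerBlDr.
set t := size ts.
have cost_p := LPS_cost_le sigma t vts pst (ltW k0) etak.
have sum_ge0 a b : 0 <= \sum_(a <= u < b) step_cost ts sigma u.
  by apply: sumr_ge0 => u _; apply: step_cost_ge0.
case: (posnP t) => [t0|t0].
  rewrite {1}/cost -/t t0 big_geq // addr_ge0 ?mulr_ge0 ?cost_ge0 ?ltW //.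
have pt := phase_start_le ts t0; have p0 := phase_start_gt0 ts t.
have last := phase_cost vts (pst _ (phase_start_idem ts t)).1 t0.
have vis : #|visited ts h (phase_start ts t) t|%:R <= n.+1%:R :> R.
  by rewrite ler_nat -[leqRHS]card_ord max_card.
have cost1 : \sum_(1 <= u < (phase_start ts t).+1) step_cost ts sigma u <= cost ts sigma.
  by rewrite [leRHS](big_cat_nat (n := (phase_start ts t).+1)) //= lerDl sum_ge0.
have cost0 : \sum_(1 <= u < phase_start ts t) step_cost ts sigma u <= cost ts sigma.
  by rewrite [leRHS](big_cat_nat (n := phase_start ts t)) ?leqW //= lerDl sum_ge0.
rewrite [leLHS](big_cat_nat (n := phase_start ts t)) ?leqW //=.
apply: lerD; last by apply: le_trans last _; rewrite ler_wpM2l.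
apply: le_trans cost_p _.
rewrite (_ : cost ts sigma * (4 * k) = 2 * k * (cost ts sigma + cost ts sigma)); last by ring.
by apply: ler_wpM2l; [rewrite mulr_ge0 ?ltW | apply: lerD].
Qed.
End Upper.

Section Lower.
Variables (R : realType) (n : nat).
Implicit Types (s : 'I_n.+1) (p t u i k T : nat).

Definition cyclic_input T : seq (task R n) :=
  mkseq (fun t s => if (t %% n.+1 == s)%N then 1 else 0) T.

(* The rank of s in the order of saturation in a phase starting at time p. *)
Definition offset p s : 'I_n.+1 :=
  Ordinal (ltn_pmod (s + (n.+1 - p.-1 %% n.+1)) (ltn0Sn n)).

Definition rev_last k i := (if i < n.+1 - k then i else n.+1 - k + (n - i))%N.

Definition reversed_predictions k : predictions n :=
  fun p s => (p + rev_last k (offset p s))%N.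

Lemma cyclic_input_at T t s : task_at (cyclic_input T) t s =
  if (t.-1 < T)%N && (t.-1 %% n.+1 == s)%N then 1 else 0.
Proof.
rewrite /task_at; have [lt|ge] := ltnP t.-1 T; first by rewrite nth_mkseq.
by rewrite nth_default ?size_mkseq.
Qed.

Lemma offsetP p i s : ((p.-1 + i) %% n.+1 == s)%N = (i %% n.+1 == offset p s)%N.
Proof.
have := divn_eq p.-1 n.+1; have := ltn_pmod p.-1 (ltn0Sn n).
rewrite /=; set q := (p.-1 %/ _)%N; set r := (p.-1 %% _)%N => ltr ->.
rewrite -addnA modnMDl -[X in (_ == X) = _](modn_small (ltn_ord s)).
rewrite -(eqn_modDr (n.+1 - r)) addnAC subnKC; last exact: ltnW.
by rewrite modnDl.
Qed.

Lemma offset_inj p : injective (offset p).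
Proof.
move=> s s' E; apply/val_inj/eqP => /=.
have /eqP <- : ((p.-1 + offset p s) %% n.+1 == s)%N.
  by rewrite offsetP modn_small.
by rewrite offsetP E modn_small.
Qed.

Lemma offset_surj p i : (i <= n)%N -> exists s, offset p s = i :> nat.
Proof.
move=> le_in; exists (inord ((p.-1 + i) %% n.+1)).
have := offsetP p i (inord ((p.-1 + i) %% n.+1)).
by rewrite inordK ?ltn_pmod // eqxx modn_small // => /esym/eqP <-.
Qed.

Lemma cyclic_saturated T p t s : (0 < p)%N ->
  saturated (cyclic_input T) p t s =
    (p + offset p s <= t)%N && (p + offset p s <= T)%N.
Proof.
move=> p0; have at_off u : (p <= u)%N -> (u.-1 %% n.+1 == s)%N ->
    (p + offset p s <= u)%N.
  move=> pu; rewrite (_ : u.-1 = p.-1 + (u - p))%N; last by lia.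
  by rewrite offsetP => /eqP <-; have := leq_mod (u - p) n.+1; lia.
apply/idP/idP => [|/andP[le_t le_T]].
  apply: contraLR => late; rewrite /saturated big_nat big1 ?ler10 // => u /andP[pu ut].
  rewrite cyclic_input_at; case: ifP => // /andP[uT /(at_off _ pu) le_u].
  by case/negP: late; apply/andP; split; lia.
rewrite /saturated (bigD1_seq (p + offset p s)%N) ?iota_uniq //=; last first.
  by rewrite mem_index_iota leq_addr ltnS.
rewrite cyclic_input_at (_ : (p + offset p s).-1 = p.-1 + offset p s)%N; last by lia.
rewrite offsetP modn_small // eqxx andbT ifT; last by lia.
by rewrite lerDl sumr_ge0 // => u _; rewrite cyclic_input_at; case: ifP.
Qed.

Lemma cyclic_phase_start T t : (0 < n)%N -> (t < T)%N ->
  phase_start (cyclic_input T) t.+1 = (n * (t %/ n)).+1.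
Proof.
move=> n0; elim: t => [|t IH] tT.
  by rewrite div0n muln0 /=; case: ifP.
have -> : phase_start (cyclic_input T) t.+2 =
  let p := phase_start (cyclic_input T) t.+1 in
  if [forall s, saturated (cyclic_input T) p t.+2 s] then t.+2 else p by [].
rewrite IH; last exact: ltnW.
rewrite /= divnS //; have := divn_eq t n; have := ltn_pmod t n0.
set q := (t %/ n)%N; set r := (t %% n)%N => lt_r Et.
have -> : (n %| t.+1)%N = (r.+1 == n).
  rewrite Et -addnS dvdn_addr ?dvdn_mull //.
  by apply/idP/eqP => [/dvdn_leq|->] //; have := lt_r; lia.
have -> : [forall s, saturated (cyclic_input T) (n * q).+1 t.+2 s] = (r.+1 == n).
  apply/forallP/eqP => [sat|En s]; last first.
    rewrite cyclic_saturated //; have := ltn_ord (offset (n * q).+1 s); lia.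
  have [s Es] := offset_surj (n * q).+1 (leqnn n).
  have := sat s; rewrite cyclic_saturated // Es; lia.
by case: eqP => //= E; rewrite mulnDr; lia.
Qed.

Lemma rev_last_inj k i j : (k <= n.+1)%N -> (i <= n)%N -> (j <= n)%N ->
  rev_last k i = rev_last k j -> i = j.
Proof. by move=> kn i_n j_n; rewrite /rev_last; case: ifP => ?; case: ifP => ?; lia. Qed.

Lemma reversed_predictions_inj k p : (k <= n.+1)%N ->
  injective (reversed_predictions k p).
Proof.
move=> kn s s' /addnI E; apply: (@offset_inj p); apply: val_inj.
by apply: rev_last_inj E => //; rewrite -ltnS.
Qed.

Lemma rev_last_error k : (k <= n.+1)%N ->
  (\sum_(i < n.+1) absz ((rev_last k i)%:Z - i%:Z) <= k * k)%N.
Proof.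
move=> kn; rewrite -(big_mkord xpredT (fun i => absz ((rev_last k i)%:Z - i%:Z))).
rewrite (big_cat_nat (n := (n.+1 - k)%N)) ?leq_subr //= big_nat big1 ?add0n; last first.
  by move=> i /andP[_ ik]; rewrite /rev_last ik subrr.
rewrite big_nat; apply: (@leq_trans (\sum_(n.+1 - k <= i < n.+1) k)%N).
  rewrite [leqRHS]big_nat; apply: leq_sum => i /andP[ki i_n].
  by rewrite /rev_last ltnNge ki /=; lia.
by rewrite sum_nat_const_nat subKn.
Qed.

Lemma cyclic_PST T k (eta0 : R) : (k <= n.+1)%N -> k%:R ^+ 2 <= eta0 ->
  PST_oracle (cyclic_input T) (reversed_predictions k) eta0.
Proof.
move=> kn keta p Ep; have p0 : (0 < p)%N by rewrite -Ep phase_start_gt0.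
split=> [|tt sat_tt]; first exact: reversed_predictions_inj.
apply: le_trans keta.
have Ett s : tt s = (p + offset p s)%N.
  have [_ sat_s _] := sat_tt s.
  rewrite cyclic_saturated // in sat_s; case/andP: sat_s => le_t le_T.
  apply/eqP; rewrite eqn_leq le_t andbT.
  by apply: saturation_time_le (sat_tt s) _; rewrite cyclic_saturated // leqnn.
rewrite /prediction_error.
rewrite (eq_bigr (fun s => (absz ((rev_last k (offset p s))%:Z - (offset p s)%:Z))%:R)).
  rewrite -natr_sum -natrX ler_nat.
  rewrite -(reindex_inj (@offset_inj p) (P := xpredT)
    (F := fun i : 'I_n.+1 => absz ((rev_last k i)%:Z - i%:Z))) /=.
  by rewrite -mulnn; apply: rev_last_error.
by move=> s _; rewrite Ett /reversed_predictions !natrD opprD addrACA subrr add0r absz_natrB.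
Qed.

Lemma cyclic_valid T : (0 < n)%N -> valid_input (cyclic_input T).
Proof.
move=> n0 t; split=> [s|]; first by rewrite cyclic_input_at; case: ifP.
exists (if (t.-1 %% n.+1 == 0)%N then ord_max else ord0).
rewrite cyclic_input_at; case: (eqVneq (t.-1 %% n.+1)%N 0%N) => [->|ne] /=.
  by rewrite ltn_eqF // andbF ltr01.
by rewrite (negPf ne) andbF ltr01.
Qed.

Lemma cyclic_LPS T k t : (0 < n)%N -> (k <= n.+1)%N -> (t < T)%N ->
  (n <= t %% n + k)%N ->
  LPS (cyclic_input T) (reversed_predictions k) t.+1 = (t.+1 %% n.+1)%N :> nat.
Proof.
move=> n0 kn tT late; have vts := cyclic_valid T n0.
set h := reversed_predictions k; set s := LPS _ _ _.
have us : ~~ saturated (cyclic_input T) (phase_start (cyclic_input T) t.+1) t.+1 s.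
  exact: LPS_unsaturated.
pose s' : 'I_n.+1 := inord (t.+1 %% n.+1)%N.
have := @LPS_latest _ _ _ h t.+1 s' vts isT; rewrite -/s.
rewrite cyclic_phase_start // in us *.
have := divn_eq t n; have := ltn_pmod t n0.
set q := (t %/ n)%N in us *; set r := (t %% n)%N in late * => lt_r Et.
have Es' : offset (n * q).+1 s' = r.+1 :> nat.
  have := offsetP (n * q).+1 r.+1 s'.
  rewrite (_ : (n * q).+1.-1 + r.+1 = t.+1)%N; last by lia.
  by rewrite inordK ?ltn_pmod // eqxx modn_small // => /esym/eqP <-.
rewrite cyclic_saturated // in us; rewrite cyclic_saturated // Es' => latest.
have {latest} : (h (n * q).+1 s' <= h (n * q).+1 s)%N by apply: latest; lia.
have := ltn_ord (offset (n * q).+1 s) => off_n.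
rewrite /h /reversed_predictions Es' leq_add2l /rev_last.
have off_r : (r < offset (n * q).+1 s)%N by lia.
rewrite !ifF; [|lia..] => le_off.
have Eoff : offset (n * q).+1 s = offset (n * q).+1 s' :> nat by rewrite Es'; lia.
have -> : s = s' by apply: (@offset_inj (n * q).+1); apply: val_inj.
by rewrite inordK ?ltn_pmod.
Qed.

Lemma sum_periodic (F : nat -> R) m :
  \sum_(0 <= i < m * n) F (i %% n)%N = m%:R * \sum_(0 <= i < n) F i.
Proof.
elim: m => [|m IH]; first by rewrite mul0n big_geq // mul0r.
rewrite mulSnr (big_cat_nat (n := (m * n)%N)) ?leq_addr //= IH -natr1 mulrDl mul1r.
congr (_ + _); rewrite -{1}[(m * n)%N]add0n big_addn addKn.
rewrite !big_mkord; apply: eq_bigr => i _.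
by rewrite addnC modnMDl modn_small.
Qed.

Lemma cost_cyclic T sigma :
  cost (cyclic_input T) sigma = \sum_(0 <= t < T) step_cost (cyclic_input T) sigma t.+1.
Proof. by rewrite /cost size_mkseq big_add1. Qed.

Lemma cyclic_LPS_cost m k : (0 < n)%N -> (1 < k)%N -> (k <= n.+1)%N ->
  m%:R * (k - 2)%:R <=
  cost (cyclic_input (m * n)) (LPS (cyclic_input (m * n)) (reversed_predictions k)).
Proof.
move=> n0 k1 kn; set ts := cyclic_input _; set h := reversed_predictions k.
have moves : \sum_(0 <= i < n) (n.+1 - k < i)%:R = (k - 2)%:R :> R.
  rewrite -natr_sum; congr _%:R.
  rewrite (big_cat_nat (n := (n.+2 - k)%N)) //=; last by lia.
  rewrite big_nat big1 ?add0n => [|i ik]; last by rewrite ltnNge (_ : i <= _)%N //; lia.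
  rewrite big_nat (eq_bigr (fun=> 1%N)) => [|i ik]; last by rewrite (_ : _ < i)%N //; lia.
  by rewrite -big_nat sum_nat_const_nat; lia.
rewrite -moves -sum_periodic cost_cyclic -/ts big_nat [leRHS]big_nat.
apply: ler_sum => t /andP[_ tT].
have vts : valid_input ts by apply: cyclic_valid.
case: ltnP => [late|_]; last exact: step_cost_ge0.
case: t tT late => [|t] tT; first by rewrite mod0n.
have step : (t.+1 %% n = (t %% n).+1 \/ t.+1 %% n = 0)%N.
  rewrite -addn1 -modnDml addn1; have := ltn_pmod t n0.
  rewrite leq_eqVlt => /predU1P[->|lt]; first by rewrite modnn; right.
  by rewrite modn_small; [left|].
move=> late; have {step} step : (t.+1 %% n = (t %% n).+1)%N.
  by case: step => // E; rewrite E in late.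
have prev := @cyclic_LPS (m * n) k t n0 kn (ltnW tT).
have next := @cyclic_LPS (m * n) k t.+1 n0 kn tT.
rewrite /step_cost /dist ifF; first by rewrite lerDl; case: (vts t.+2).
apply/eqP => /(congr1 (@nat_of_ord _)).
rewrite [LHS]prev ?[RHS]next; [move=> E|lia..].
have : (t.+1 + 0 == t.+1 + 1 %[mod n.+1])%N by rewrite addn0 addn1; apply/eqP.
by rewrite eqn_modDl mod0n modn_small.
Qed.

(* The last state to be saturated in the phase of time t. *)
Definition last_state : schedule n := fun t =>
  if t is t'.+1 then inord ((n * (t' %/ n).+1) %% n.+1) else ord0.

Lemma cyclic_opt m : (0 < n)%N -> opt (cyclic_input (m * n)) <= m%:R.
Proof.
move=> n0; have vts := cyclic_valid (m * n) n0.
apply: le_trans (@opt_le _ _ _ last_state vts (erefl _)) _.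
have starts : \sum_(0 <= i < n) (i == 0)%N%:R = 1 :> R.
  case: n n0 => // n' _; rewrite big_nat_recl //= big1 ?addr0 //.
have -> : m%:R = \sum_(0 <= t < m * n) (t %% n == 0)%N%:R :> R.
  by rewrite (sum_periodic (fun i => (i == 0)%N%:R)) starts mulr1.
rewrite cost_cyclic big_nat [leRHS]big_nat.
apply: ler_sum => t /andP[_ tT].
have idle : task_at (cyclic_input (m * n)) t.+1 (last_state t.+1) = 0.
  rewrite cyclic_input_at tT /= inordK ?ltn_pmod // ifF //.
  have := divn_eq t n; have := ltn_pmod t n0.
  set q := (t %/ n)%N; set r := (t %% n)%N => lt_r Et.
  rewrite eq_sym eqn_mod_dvd; last by lia.
  rewrite (_ : n * q.+1 - t = n - r)%N; last by lia.
  by apply/negP => /dvdn_leq; lia.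
rewrite /step_cost idle addr0.
have [_|] := eqVneq (t %% n)%N 0%N; first exact: dist_le1.
case: t {tT idle} => [|t]; first by rewrite mod0n.
rewrite /= divnS // -/(dvdn n t.+1) => /negPf; rewrite /dvdn => ->.
by rewrite /dist eqxx.
Qed.

Lemma LPS_lower (eta0 c : R) k : (0 < n)%N -> (1 < k)%N -> (k <= n.+1)%N ->
  k%:R ^+ 2 <= eta0 -> competitive (@LPS R n) eta0 c -> (k - 2)%:R <= Num.max c 0.
Proof.
move=> n0 k1 kn keta [b comp]; rewrite leNgt; apply/negP => lt_c.
have gap0 : 0 < (k - 2)%:R - Num.max c 0 by rewrite subr_gt0.
have [m lt_m] : exists m : nat, b < m%:R * ((k - 2)%:R - Num.max c 0).
  exists (Num.truncn (b / ((k - 2)%:R - Num.max c 0))).+1.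
  by rewrite -ltr_pdivrMr // truncnS_gt.
have vts := cyclic_valid (m * n) n0.
have upper := comp _ _ vts (cyclic_PST kn keta).
have lower := cyclic_LPS_cost m n0 k1 kn.
have opt0 : 0 <= opt (cyclic_input (m * n)) by apply: opt_ge => *; apply: cost_ge0.
have c_le : c * opt (cyclic_input (m * n)) <= Num.max c 0 * m%:R.
  apply: (@le_trans _ _ (Num.max c 0 * opt (cyclic_input (m * n)))).
    by rewrite ler_wpM2r // le_max lexx.
  by rewrite ler_wpM2l ?cyclic_opt // le_max lexx orbT.
have := le_trans lower upper; rewrite leNgt => /negP; apply.
by rewrite mulrBr [X in _ - X]mulrC in lt_m; lra.
Qed.
End Lower.

Theorem mainTheorem2 (R : realType) :
  exists c1 c2 e0 : R,
    [/\ 0 < c1, 0 < c2 &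
      forall eta0 : R, e0 <= eta0 ->
        (forall n : nat,
           competitive (@LPS R n) eta0 (c2 * Num.sqrt eta0)) /\
        (forall n : nat, Num.sqrt eta0 <= n.+1%:R ->
           forall c : R, competitive (@LPS R n) eta0 c ->
             c1 * Num.sqrt eta0 <= c)].
Proof.
exists 4^-1, 12, 9; split; rewrite ?invr_gt0 ?ltr0n // => eta0 eta9.
have eta_ge0 : 0 <= eta0 by lra.
have sqr := sqr_sqrtr eta_ge0.
have sqrt3 : 3 <= Num.sqrt eta0.
  by rewrite -(ler_pXn2r (n := 2)) ?nnegrE ?sqrtr_ge0 // sqr; lra.
split=> [n|n le_n c comp].
  rewrite (_ : 12 * Num.sqrt eta0 = 4 * (3 * Num.sqrt eta0)); last by ring.
  apply: LPS_competitive; first by rewrite mulr_gt0 //; lra.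
  by rewrite exprMn sqr; lra.
pose k := Num.truncn (Num.sqrt eta0).
have k_le : k%:R <= Num.sqrt eta0 by rewrite truncn_le sqrtr_ge0.
have k_gt : Num.sqrt eta0 < k.+1%:R by apply: truncnS_gt.
have k3 : (3 <= k)%N by rewrite truncn_ge_nat ?sqrtr_ge0.
have kn : (k <= n.+1)%N by rewrite -(ler_nat R) (le_trans k_le).
have keta : k%:R ^+ 2 <= eta0 by rewrite -sqr ler_pXn2r ?nnegrE ?sqrtr_ge0.
have k4 : k.+1%:R <= 4 * (k - 2)%:R :> R by rewrite -natrM ler_nat; lia.
have n0 : (0 < n)%N by lia.
have := LPS_lower n0 (ltnW k3) kn keta comp.
by rewrite le_max => /orP[]; lra.
Qed.
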